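(* Let $(A,\cdot_A,a_A)$ be a left-symmetric algebroid over $M$ with sub-adjacent Lie algebroid $G(A)$, and let $L^*$ be the dual representation of the left multiplication representation $L$ of $G(A)$ on $A$. Then the $2$-form $\omega$ on $A\oplus A^*$ given by $$\omega(x+\xi,y+\eta)=\langle\eta,x\rangle-\langle\xi,y\rangle,\qquad x,y\in\Gamma(A),\ \xi,\eta\in\Gamma(A^* ),$$ is a nondegenerate closed $2$-form on the semidirect product Lie algebroid $G(A)\ltimes_{L^*}A^*$. Thus $G(A)\ltimes_{L^*}A^*$ is a phase space of the Lie algebroid $G(A)$.
   Context: All vector bundles are over the same smooth manifold $M$; bundle maps cover the identity of $M$. A left-symmetric algebra is a vector space with a bilinear product $\cdot$ such that $(x\cdot y)\cdot z-x\cdot(y\cdot z)=(y\cdot x)\cdot z-y\cdot(x\cdot z)$. A left-symmetric algebroid $(A,\cdot_A,a_A)$ is a vector bundle $A\to M$ with an ($\mathbb{R}$-bilinear) left-symmetric algebra structure $\cdot_A$ on $\Gamma(A)$ and a bundle map $a_A:A\to TM$ such that $x\cdot_A(fy)=f(x\cdot_A y)+a_A(x)(f)y$ and $(fx)\cdot_A y=f(x\cdot_A y)$ for $f\in C^\infty(M)$, $x,y\in\Gamma(A)$. Its sub-adjacent Lie algebroid $G(A)$ is $A$ with bracket $[x,y]_A=x\cdot_A y-y\cdot_A x$ and anchor $a_A$. The map $x\mapsto L_x$, $L_x(y)=x\cdot_A y$, is a representation of $G(A)$ on $A$; its dual representation on $A^*$ is $\langle L_x^*\xi,y\rangle=a_A(x)\langle\xi,y\rangle-\langle\xi,x\cdot_A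 y\rangle$. The semidirect product $G(A)\ltimes_{L^*}A^*$ is the Lie algebroid $A\oplus A^*$ with anchor $x+\xi\mapsto a_A(x)$ and bracket $[x+\xi,y+\eta]_s=[x,y]_A+L_x^*\eta-L_y^*\xi$. For a Lie algebroid $(B,[\cdot,\cdot]_B,a_B)$, a $2$-form $\varpi\in\Gamma(\Lambda^2B^* )$ is closed (a $2$-cocycle) if $d\varpi=0$, where $d$ is the Lie algebroid differential: $d\varpi(x,y,z)=a_B(x)\varpi(y,z)-a_B(y)\varpi(x,z)+a_B(z)\varpi(x,y)-\varpi([x,y]_B,z)+\varpi([x,z]_B,y)-\varpi([y,z]_B,x)$. Phase space: let $B$ be a Lie algebroid and suppose there is a Lie algebroid structure on the dual bundle $B^*$. If there is a Lie algebroid structure on $\mathcal P=B\oplus B^*$ such that $B$ and $B^*$ are Lie subalgebroids and the natural $2$-form $(x+\xi,y+\eta)\mapsto\langle\eta,x\rangle-\langle\xi,y\rangle$ is a $2$-cocycle, then $\mathcal P$ is called a phase space of $B$. *)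

(* Defs.v *)
From HB Require Import structures.
From mathcomp Require Import all_boot all_order all_algebra.
From mathcomp Require Import all_classical all_reals all_analysis.

Set Implicit Arguments.
Unset Strict Implicit.
Unset Printing Implicit Defensive.

Import Order.TTheory GRing.Theory Num.Theory.
Import numFieldNormedType.Exports.

Local Open Scope classical_set_scope.
Local Open Scope ring_scope.

Lemma near_eq_differentiable (R : realType) (V W : normedModType R)
    (f g : V -> W) (x : V) :
  (\near x, f x = g x) -> differentiable f x -> differentiable g x.
Proof.
move=> fg /diff_locallyP[cf Ef].
have Eg : g \o shift x = cst (g x) + 'd f x +o_ 0 id.
  apply/eqaddoP => e e0; have /eqaddoP/(_ e e0) H := Ef.
  have fg0 : \forall h \near (0 : V), f (h + x) = g (h + x).
    by move: fg; rewrite (near_shift 0) /=; apply: filterS => h; rewrite /= subr0.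
  near=> h.
  have H1 : (f \o shift x - (cst (f x) + ('d f x : V -> W))) h
     = (g \o shift x - (cst (g x) + ('d f x : V -> W))) h.
    rewrite !fctE /= (nbhs_singleton fg); congr (_ - _).
    by near: h.
  rewrite -H1; near: h; exact: H.
have dg := diff_unique cf Eg.
by apply/diff_locallyP; rewrite dg; split.
Unshelve. all: by end_near. Qed.

Section Smooth.
Context {R : realType} {n : nat}.
Implicit Types (U V : set 'rV[R]_n) (f g : 'rV[R]_n -> R).

Fixpoint Ck (k : nat) U f : Prop :=
  match k with
  | 0 => forall x, U x -> {for x, continuous f}
  | k'.+1 => (forall x, U x -> differentiable f x) /\
             (forall v : 'rV[R]_n, Ck k' U ('D_v f))
  end.

Definition smooth U f := forall k, Ck k U f.

Lemma Ck_eq k U f g : open U -> {in U, f =1 g} -> Ck k U f -> Ck k U g.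
Proof.
move=> oU; elim: k f g => [|k IH] f g fg /=.
  move=> H x Ux; have fgx : \near x, f x = g x.
    by near=> y; apply/fg/mem_set; near: y; exact: open_nbhs_nbhs.
  rewrite /prop_for /continuous_at -(nbhs_singleton fgx).
  exact: cvg_trans (near_eq_cvg fgx) (H x Ux).
move=> [df Df]; split=> [x Ux|v].
  apply: near_eq_differentiable (df x Ux).
  by near=> y; apply/fg/mem_set; near: y; exact: open_nbhs_nbhs.
apply: IH (Df v) => x /set_mem Ux; apply: near_eq_derive.
by near=> y; apply/fg/mem_set; near: y; exact: open_nbhs_nbhs.
Unshelve. all: by end_near. Qed.

Lemma CkS k U f : Ck k.+1 U f -> Ck k U f.
Proof.
elim: k f => [|k IH] f /=.
  by move=> [df _] x Ux; exact: differentiable_continuous (df x Ux).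
by move=> [df Df]; split=> // v; apply: IH; exact: Df.
Qed.

Lemma sub_Ck k U V f : U `<=` V -> Ck k V f -> Ck k U f.
Proof.
move=> UV; elim: k f => [|k IH] f /=; first by move=> H x /UV; exact: H.
by move=> [df Df]; split=> [x /UV /df //|v]; exact: IH.
Qed.

Lemma Ck_bigcup k (I : Type) (U : I -> set 'rV[R]_n) f :
  (forall i, Ck k (U i) f) -> Ck k (\bigcup_i U i) f.
Proof.
elim: k f => [|k IH] f /= H; first by move=> x [i _ Ux]; exact: (H i).
split=> [x [i _ Ux]|v]; first exact: (H i).1.
by apply: IH => i; exact: (H i).2.
Qed.

Lemma Ck_cst k U (c : R) : Ck k U (fun=> c).
Proof.
elim: k c => [|k IH] c /=; first by move=> x _; exact: cst_continuous.
split=> [x _|v]; first exact: differentiable_cst.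
suff -> : 'D_v (fun=> c) = (fun=> 0) :> ('rV[R]_n -> R) by exact: IH.
by apply/funext => x; exact: derive_cst.
Qed.

Lemma CkD k U f g : open U -> Ck k U f -> Ck k U g ->
  Ck k U (fun x => f x + g x).
Proof.
move=> oU; elim: k f g => [|k IH] f g /=.
  by move=> cf cg x Ux; apply: continuousD; [exact: cf|exact: cg].
move=> [df Df] [dg Dg]; split=> [x Ux|v].
  by apply: differentiableD; [exact: df|exact: dg].
apply: Ck_eq (IH _ _ (Df v) (Dg v)) => // x /set_mem Ux.
by rewrite -deriveD //; apply: diff_derivable; [exact: df|exact: dg].
Qed.

Lemma CkM k U f g : open U -> Ck k U f -> Ck k U g ->
  Ck k U (fun x => f x * g x).
Proof.
move=> oU; elim: k f g => [|k IH] f g.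
  by move=> cf cg x Ux; apply: continuousM; [exact: cf|exact: cg].
move=> Cf Cg; have Cf' := CkS Cf; have Cg' := CkS Cg.
case: Cf Cg => [df Df] [dg Dg]; split=> [x Ux|v].
  by apply: differentiableM; [exact: df|exact: dg].
apply: (@Ck_eq _ _ (fun x => f x * 'D_v g x + g x * 'D_v f x)) => //.
  move=> x /set_mem Ux.
  have df' : derivable f x v by apply: diff_derivable; exact: df.
  have dg' : derivable g x v by apply: diff_derivable; exact: dg.
  by rewrite -[LHS](deriveM df' dg').
by apply: CkD => //; [exact: (IH _ _ Cf' (Dg v))|exact: (IH _ _ Cg' (Df v))].
Qed.

End Smooth.

(* An n-dimensional smooth manifold without boundary, given by an atlas; [cmap c]
   and [cinv c] are meaningful on [cdom c] and on its image only. *)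
Record manifold (R : realType) (n : nat) := Manifold {
  mcarrier :> topologicalType;
  mhausdorff : hausdorff_space mcarrier;
  msecond_countable : @second_countable mcarrier;
  chart : Type;
  cdom : chart -> set mcarrier;
  cmap : chart -> mcarrier -> 'rV[R]_n;
  cinv : chart -> 'rV[R]_n -> mcarrier;
  cdom_open : forall c, open (cdom c);
  cimg_open : forall c, open (cmap c @` cdom c);
  cmapK : forall c p, cdom c p -> cinv c (cmap c p) = p;
  cmap_cont : forall c p, cdom c p -> {for p, continuous (cmap c)};
  cinv_cont : forall c x, (cmap c @` cdom c) x -> {for x, continuous (cinv c)};
  cdom_cover : forall p, exists c, cdom c p;
  chart_smooth : forall c d (k : 'I_n),
    smooth (cmap c @` (cdom c `&` cdom d)) (fun x => cmap d (cinv c x) ord0 k)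
}.

Section Functions.
Context {R : realType} {n : nat} {M : manifold R n}.
Implicit Types (W : set M) (f g : M -> R) (c : chart M).

Definition msmooth W f :=
  forall c, smooth (cmap c @` (cdom c `&` W)) (f \o cinv c).

Lemma cimgI_open c W : open W -> open (cmap c @` (cdom c `&` W)).
Proof.
move=> oW.
rewrite openE => x [p [cp Wp] <-{x}]; rewrite /interior.
have img : (cmap c @` cdom c) (cmap c p) by exists p.
have := cinv_cont img; rewrite /prop_for /continuous_at cmapK // => /(_ W).
move=> /(_ (open_nbhs_nbhs (conj oW Wp))) nW.
have nI : nbhs (cmap c p) (cmap c @` cdom c).
  by apply: open_nbhs_nbhs; split=> //; exact: cimg_open.
have {}nW : nbhs (cmap c p) (cinv c @^-1` W) by exact: nW.
apply: filterS (filterI nW nI) => x [/= Wx [q cq qx]]; exists q => //.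
by split=> //; move: Wx; rewrite -qx cmapK.
Qed.

Lemma msmooth_eq W f g : open W -> (forall p, W p -> f p = g p) ->
  msmooth W f -> msmooth W g.
Proof.
move=> oW fg sf c k; apply: Ck_eq (sf c k); first exact: cimgI_open.
by move=> x /set_mem[p [cp Wp] <-] /=; rewrite cmapK // fg.
Qed.

Lemma sub_msmooth W W' f : W `<=` W' -> msmooth W' f -> msmooth W f.
Proof.
move=> WW' sf c k; apply: sub_Ck (sf c k).
by apply: image_subset; exact: setIS.
Qed.

Lemma msmooth_cover (I : Type) (W : I -> set M) f :
  (forall p, exists i, W i p) -> (forall i, msmooth (W i) f) -> msmooth setT f.
Proof.
move=> cW sf c k.
apply: (@sub_Ck _ _ _ _ (\bigcup_i (cmap c @` (cdom c `&` W i)))).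
  by move=> x [p [cp _] <-]; have [i Wi] := cW p; exists i => //; exists p.
by apply: Ck_bigcup => i; exact: sf.
Qed.

Lemma msmooth_cst W (a : R) : msmooth W (fun=> a).
Proof. by move=> c k; exact: Ck_cst. Qed.

Lemma msmoothD W f g : open W -> msmooth W f -> msmooth W g ->
  msmooth W (fun p => f p + g p).
Proof.
by move=> oW sf sg c k; exact: CkD (cimgI_open oW) (sf c k) (sg c k).
Qed.

Lemma msmoothM W f g : open W -> msmooth W f -> msmooth W g ->
  msmooth W (fun p => f p * g p).
Proof.
by move=> oW sf sg c k; exact: CkM (cimgI_open oW) (sf c k) (sg c k).
Qed.

Lemma msmooth_sum W (I : Type) (s : seq I) (P : pred I) (F : I -> M -> R) :
  open W -> (forall i, msmooth W (F i)) ->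
  msmooth W (fun p => \sum_(i <- s | P i) F i p).
Proof.
move=> oW sF; elim: s => [|i s IH].
  have -> : (fun p => \sum_(i <- [::] | P i) F i p) = (fun=> 0).
    by apply/funext => p; rewrite big_nil.
  exact: msmooth_cst.
have -> : (fun p => \sum_(j <- i :: s | P j) F j p) =
   (fun p => (if P i then F i p else 0) + \sum_(j <- s | P j) F j p).
  by apply/funext => p; rewrite big_cons; case: ifP; rewrite ?add0r.
by apply: msmoothD => //; case: (P i) => //; exact: msmooth_cst.
Qed.

End Functions.

Record cinf (R : realType) (n : nat) (M : manifold R n) := Cinf {
  cinf_fun :> M -> R;
  cinfP : msmooth setT cinf_fun
}.

Section CinfRing.
Context {R : realType} {n : nat} (M : manifold R n).
Implicit Types f g h : cinf M.

Lemma cinf_ext f g : (forall p, f p = g p) -> f = g.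
Proof.
case: f g => [f sf] [g sg] /= /funext fg; move: sf sg.
by rewrite fg => sf sg; congr Cinf; exact: Prop_irrelevance.
Qed.

Definition cinf_cst (a : R) : cinf M := Cinf (msmooth_cst setT a).
Definition cinf_add f g : cinf M := Cinf (msmoothD openT (cinfP f) (cinfP g)).
Definition cinf_mul f g : cinf M := Cinf (msmoothM openT (cinfP f) (cinfP g)).
Definition cinf_opp f : cinf M := cinf_mul (cinf_cst (-1)) f.

HB.instance Definition _ := gen_eqMixin (cinf M).
HB.instance Definition _ := gen_choiceMixin (cinf M).

Fact cinf_addA : associative cinf_add.
Proof. by move=> f g h; apply: cinf_ext => p /=; rewrite addrA. Qed.
Fact cinf_addC : commutative cinf_add.
Proof. by move=> f g; apply: cinf_ext => p /=; rewrite addrC. Qed.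
Fact cinf_add0 : left_id (cinf_cst 0) cinf_add.
Proof. by move=> f; apply: cinf_ext => p /=; rewrite add0r. Qed.
Fact cinf_addN : left_inverse (cinf_cst 0) cinf_opp cinf_add.
Proof. by move=> f; apply: cinf_ext => p /=; rewrite mulN1r addNr. Qed.
Fact cinf_mulA : associative cinf_mul.
Proof. by move=> f g h; apply: cinf_ext => p /=; rewrite mulrA. Qed.
Fact cinf_mulC : commutative cinf_mul.
Proof. by move=> f g; apply: cinf_ext => p /=; rewrite mulrC. Qed.
Fact cinf_mul1 : left_id (cinf_cst 1) cinf_mul.
Proof. by move=> f; apply: cinf_ext => p /=; rewrite mul1r. Qed.
Fact cinf_mulDl : left_distributive cinf_mul cinf_add.
Proof. by move=> f g h; apply: cinf_ext => p /=; rewrite mulrDl. Qed.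

HB.instance Definition _ := GRing.isZmodule.Build (cinf M)
  cinf_addA cinf_addC cinf_add0 cinf_addN.
HB.instance Definition _ := GRing.Zmodule_isComPzRing.Build (cinf M)
  cinf_mulA cinf_mulC cinf_mul1 cinf_mulDl.

Lemma cinfD f g p : (f + g) p = f p + g p. Proof. by []. Qed.
Lemma cinfM f g p : (f * g) p = f p * g p. Proof. by []. Qed.
Lemma cinfN f p : (- f) p = - f p. Proof. exact: mulN1r. Qed.
Lemma cinf0 p : (0 : cinf M) p = 0. Proof. by []. Qed.
Lemma cinf1 p : (1 : cinf M) p = 1. Proof. by []. Qed.

End CinfRing.

(* A vector bundle, given by its fibres and local frames; [frame i p] is
   meaningful for [p] in [tdom i], and any two frames differ by a smooth matrix.
   The rank may depend on the connected component of the base. *)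
Record vbundle (R : realType) (n : nat) (M : manifold R n) := VBundle {
  fiber :> M -> vectType R;
  triv : Type;
  tdom : triv -> set M;
  trank : triv -> nat;
  frame : forall (i : triv) (p : M), (trank i).-tuple (fiber p);
  tdom_open : forall i, open (tdom i);
  tdom_cover : forall p, exists i, tdom i p;
  frame_basis : forall i p, tdom i p -> basis_of fullv (frame i p);
  frame_smooth : forall i j (a : 'I_(trank i)) (b : 'I_(trank j)),
    msmooth (tdom i `&` tdom j) (fun p => coord (frame i p) a (tnth (frame j p) b))
}.

Record section (R : realType) (n : nat) (M : manifold R n) (E : vbundle M) :=
  MkSection {
  sec_fun :> forall p, E p;
  sec_smooth : forall i (a : 'I_(trank i)),
    msmooth (tdom i) (fun p => coord (frame i p) a (sec_fun p))
}.

Section Sections.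
Context {R : realType} {n : nat} {M : manifold R n} (E : vbundle M).
Implicit Types (x y z : section E) (f g : cinf M).

Lemma section_ext x y : (forall p, x p = y p) -> x = y.
Proof.
case: x y => [x sx] [y sy] /= xy.
have {}xy : x = y by exact: functional_extensionality_dep.
by move: sx sy; rewrite xy => sx sy; congr MkSection; exact: Prop_irrelevance.
Qed.

Fact sec0_subproof i (a : 'I_(trank i)) :
  msmooth (tdom i) (fun p => coord (frame i p) a (0 : E p)).
Proof.
apply: msmooth_eq (msmooth_cst _ 0); first exact: tdom_open.
by move=> p _; rewrite linear0.
Qed.
Definition sec_zero : section E := MkSection sec0_subproof.

Fact sec_add_subproof x y i (a : 'I_(trank i)) :
  msmooth (tdom i) (fun p => coord (frame i p) a (x p + y p)).
Proof.
apply: msmooth_eq (msmoothD (tdom_open i) (sec_smooth x a) (sec_smooth y a)).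
  exact: tdom_open.
by move=> p _; rewrite linearD.
Qed.
Definition sec_add x y : section E := MkSection (sec_add_subproof x y).

Fact sec_scale_subproof f x i (a : 'I_(trank i)) :
  msmooth (tdom i) (fun p => coord (frame i p) a (f p *: x p)).
Proof.
have sf : msmooth (tdom i) f by apply: sub_msmooth (cinfP f).
apply: msmooth_eq (msmoothM (tdom_open i) sf (sec_smooth x a)).
  exact: tdom_open.
by move=> p _; rewrite linearZ.
Qed.
Definition sec_scale f x : section E := MkSection (sec_scale_subproof f x).
Definition sec_opp x : section E := sec_scale (-1) x.

HB.instance Definition _ := gen_eqMixin (section E).
HB.instance Definition _ := gen_choiceMixin (section E).

Fact sec_addA : associative sec_add.
Proof. by move=> x y z; apply: section_ext => p /=; rewrite addrA. Qed.
Fact sec_addC : commutative sec_add.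
Proof. by move=> x y; apply: section_ext => p /=; rewrite addrC. Qed.
Fact sec_add0 : left_id sec_zero sec_add.
Proof. by move=> x; apply: section_ext => p /=; rewrite add0r. Qed.
Fact sec_addN : left_inverse sec_zero sec_opp sec_add.
Proof.
by move=> x; apply: section_ext => p /=; rewrite mulr1 scaleN1r addNr.
Qed.

HB.instance Definition _ := GRing.isZmodule.Build (section E)
  sec_addA sec_addC sec_add0 sec_addN.

Fact sec_scaleA f g x : sec_scale f (sec_scale g x) = sec_scale (f * g) x.
Proof. by apply: section_ext => p /=; rewrite scalerA. Qed.
Fact sec_scale1 : left_id 1 sec_scale.
Proof. by move=> x; apply: section_ext => p /=; rewrite scale1r. Qed.
Fact sec_scaleDr : right_distributive sec_scale +%R.
Proof. by move=> f x y; apply: section_ext => p /=; rewrite scalerDr. Qed.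
Fact sec_scaleDl x : {morph sec_scale^~ x : f g / f + g}.
Proof. by move=> f g; apply: section_ext => p /=; rewrite scalerDl. Qed.

HB.instance Definition _ := GRing.Zmodule_isLmodule.Build (cinf M) (section E)
  sec_scaleA sec_scale1 sec_scaleDr sec_scaleDl.

Lemma secD x y p : (x + y) p = x p + y p. Proof. by []. Qed.
Lemma secZ f x p : (f *: x) p = f p *: x p. Proof. by []. Qed.
Lemma sec0 p : (0 : section E) p = 0. Proof. by []. Qed.
Lemma secN x p : (- x) p = - x p.
Proof. by rewrite -scaleN1r secZ cinfN cinf1 scaleN1r. Qed.

End Sections.

Section Bases.
Context {K : fieldType}.

Lemma coord_criterion (V : vectType K) n (X : n.-tuple V) (c : 'I_n -> V -> K) :
  (forall v, v = \sum_a c a v *: tnth X a) ->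
  (forall (k : 'I_n -> K) a, c a (\sum_b k b *: tnth X b) = k a) ->
  basis_of fullv X /\ (forall a v, coord X a v = c a v).
Proof.
move=> Ev Ec.
have fX : free X.
  apply/freeP => k k0 a.
  have E0 : \sum_b k b *: tnth X b = \sum_b (0 : K) *: tnth X b.
    rewrite [RHS]big1 => [|b _]; last exact: scale0r.
    by rewrite -[RHS]k0; apply: eq_bigr => b _; rewrite (tnth_nth 0).
  by rewrite -(Ec k a) E0 (Ec (fun=> 0)).
split=> [|a v].
  rewrite /basis_of fX andbT eqEsubv subvf /=; apply/subvP => v _.
  rewrite (Ev v); apply: memv_suml => a _; apply: memvZ.
  by apply: memv_span; exact: mem_tnth.
rewrite {1}(Ev v) -(coord_sum_free (c^~ v) a fX); congr coord.
by apply: eq_bigr => b _; rewrite (tnth_nth 0).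
Qed.

Lemma basis_sum (V : vectType K) n (X : n.-tuple V) v :
  basis_of fullv X -> v = \sum_a coord X a v *: tnth X a.
Proof.
move=> bX; rewrite {1}(coord_basis bX (memvf v)).
by apply: eq_bigr => a _; rewrite (tnth_nth 0).
Qed.

Lemma basis_coord (V : vectType K) n (X : n.-tuple V) (k : 'I_n -> K) a :
  basis_of fullv X -> coord X a (\sum_b k b *: tnth X b) = k a.
Proof.
move=> bX; rewrite -[RHS](coord_sum_free k a (basis_free bX)); congr coord.
by apply: eq_bigr => b _; rewrite (tnth_nth 0).
Qed.

Definition dual_tuple (V : vectType K) n (X : n.-tuple V) :
    n.-tuple 'Hom(V, K^o) :=
  [tuple linfun (coord X a : V -> K^o) | a < n].

Lemma dual_tupleP (V : vectType K) n (X : n.-tuple V) : basis_of fullv X ->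
  basis_of fullv (dual_tuple X) /\
  (forall a (phi : 'Hom(V, K^o)), coord (dual_tuple X) a phi = phi (tnth X a)).
Proof.
move=> bX; apply: (@coord_criterion 'Hom(V, K^o) n (dual_tuple X)
  (fun a (phi : 'Hom(V, K^o)) => phi (tnth X a) : K)).
  move=> phi; apply/lfunP => v; rewrite sum_lfunE {1}(basis_sum v bX) linear_sum.
  apply: eq_bigr => a _.
  by rewrite tnth_mktuple scale_lfunE lfunE /= linearZ; exact: mulrC.
move=> k a; rewrite sum_lfunE -[RHS](basis_coord k a bX) linear_sum /=.
apply: eq_bigr => b _; rewrite tnth_mktuple scale_lfunE lfunE /= linearZ /=.
congr (_ * _); rewrite !(tnth_nth 0) !coord_free ?(basis_free bX) //.
by rewrite eq_sym.
Qed.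

Definition sum_tuple (V W : vectType K) m n (X : m.-tuple V) (Y : n.-tuple W) :
    (m + n).-tuple (V * W)%type :=
  [tuple of [tuple (tnth X a, 0) | a < m] ++ [tuple (0, tnth Y b) | b < n]].

Definition sum_coord (V W : vectType K) m n (X : m.-tuple V) (Y : n.-tuple W)
    (a : 'I_(m + n)) (u : (V * W)%type) : K :=
  match fintype.split a with inl a => coord X a u.1 | inr b => coord Y b u.2 end.

Lemma sum_tupleP (V W : vectType K) m n (X : m.-tuple V) (Y : n.-tuple W) :
  basis_of fullv X -> basis_of fullv Y ->
  basis_of fullv (sum_tuple X Y) /\
  (forall a u, coord (sum_tuple X Y) a u = sum_coord X Y a u).
Proof.
move=> bX bY.
have E (k : 'I_(m + n) -> K) : \sum_a k a *: tnth (sum_tuple X Y) a =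
    (\sum_a k (lshift n a) *: tnth X a, \sum_b k (rshift m b) *: tnth Y b).
  rewrite big_split_ord /=.
  under eq_bigr do rewrite tnth_lshift tnth_mktuple.
  under [X in _ + X]eq_bigr do rewrite tnth_rshift tnth_mktuple.
  apply/eqP; rewrite xpair_eqE; apply/andP; split; apply/eqP.
    rewrite /= (raddf_sum fst) (raddf_sum fst) /= [X in _ + X]big1 ?addr0 //.
    by move=> b _; rewrite /= scaler0.
  rewrite /= (raddf_sum snd) (raddf_sum snd) /= [X in X + _]big1 ?add0r //.
  by move=> b _; rewrite /= scaler0.
apply: (coord_criterion (c := sum_coord X Y)) => [[u v]|k a].
  rewrite E [u in LHS](basis_sum u bX) [v in LHS](basis_sum v bY).
  by congr (_, _); apply: eq_bigr => a _;
    rewrite /sum_coord ?(unsplitK (inl a)) ?(unsplitK (inr a)).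
rewrite E /sum_coord; case: (split_ordP a) => b -> /=.
  by rewrite basis_coord.
by rewrite basis_coord.
Qed.

End Bases.

Section Dual.
Context {R : realType} {n : nat} {M : manifold R n} (E : vbundle M).

Let dfiber (p : M) : vectType R := 'Hom(E p, R^o).
Let dframe (i : triv E) (p : M) : (trank i).-tuple (dfiber p) :=
  dual_tuple (frame i p).

Fact dframe_smooth i j (a : 'I_(trank i)) (b : 'I_(trank j)) :
  msmooth (tdom i `&` tdom j)
    (fun p => coord (dframe i p) a (tnth (dframe j p) b)).
Proof.
have oI := openI (tdom_open i) (tdom_open j).
rewrite setIC in oI *.
apply: msmooth_eq (frame_smooth b a) => // p [jp ip] /=.
rewrite (dual_tupleP (frame_basis ip)).2 tnth_mktuple lfunE /=.
by [].
Qed.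

Definition dual_bundle : vbundle M := {|
  fiber := dfiber;
  frame := dframe;
  tdom_open := @tdom_open _ _ _ E;
  tdom_cover := @tdom_cover _ _ _ E;
  frame_basis := fun i p ip => (dual_tupleP (frame_basis ip)).1;
  frame_smooth := dframe_smooth
|}.

Fact pairing_subproof (xi : section dual_bundle) (x : section E) :
  msmooth setT (fun p => (xi p : 'Hom(E p, R^o)) (x p)).
Proof.
apply: (msmooth_cover (@tdom_cover _ _ _ E)) => i.
apply: (@msmooth_eq _ _ _ _ (fun p => \sum_(a < trank i)
    coord (frame i p) a (x p) * coord (dframe i p) a (xi p))).
- exact: tdom_open.
- move=> p ip; rewrite [x p in RHS](basis_sum (x p) (frame_basis ip)).
  rewrite linear_sum; apply: eq_bigr => a _.
  by rewrite linearZ (dual_tupleP (frame_basis ip)).2.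
apply: msmooth_sum; first exact: tdom_open.
move=> a; apply: msmoothM; [exact: tdom_open|exact: sec_smooth|].
exact: (@sec_smooth _ _ _ _ xi i a).
Qed.

Definition pairing xi x : cinf M := Cinf (pairing_subproof xi x).

End Dual.

Section DirectSum.
Context {R : realType} {n : nat} {M : manifold R n} (E F : vbundle M).

Let sfiber (p : M) : vectType R := (E p * F p)%type.
Let sdom (i : triv E * triv F) : set M := tdom i.1 `&` tdom i.2.
Let sframe (i : triv E * triv F) (p : M) :
    (trank i.1 + trank i.2).-tuple (sfiber p) :=
  sum_tuple (frame i.1 p) (frame i.2 p).

Fact sdom_open i : open (sdom i).
Proof. by apply: openI; exact: tdom_open. Qed.

Fact sdom_cover p : exists i, sdom i p.
Proof.
by have [i ip] := tdom_cover E p; have [j jp] := tdom_cover F p; exists (i, j).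
Qed.

Fact sframe_basis i p : sdom i p -> basis_of fullv (sframe i p).
Proof. by case=> ip jp; exact: (sum_tupleP (frame_basis ip) (frame_basis jp)).1. Qed.

Lemma sframe_coord i p a (u : sfiber p) : sdom i p ->
  coord (sframe i p) a u = sum_coord (frame i.1 p) (frame i.2 p) a u.
Proof. by case=> ip jp; exact: (sum_tupleP (frame_basis ip) (frame_basis jp)).2. Qed.

Fact sframe_smooth i j (a : 'I_(trank i.1 + trank i.2))
    (b : 'I_(trank j.1 + trank j.2)) :
  msmooth (sdom i `&` sdom j)
    (fun p => coord (sframe i p) a (tnth (sframe j p) b)).
Proof.
have oI := openI (sdom_open i) (sdom_open j).
pose g p := sum_coord (frame i.1 p) (frame i.2 p) a (tnth (sframe j p) b).
apply: (@msmooth_eq _ _ _ _ g) => // [p [ip _]|]; first by rewrite sframe_coord.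
rewrite /g {g} /sum_coord; case: (split_ordP a) => {}a _;
  case: (split_ordP b) => {}b ->.
- apply: (@msmooth_eq _ _ _ _
    (fun p => coord (frame i.1 p) a (tnth (frame j.1 p) b))) => //.
    by move=> p _; rewrite tnth_lshift tnth_mktuple.
  by apply: sub_msmooth (frame_smooth a b) => p [[? _] [? _]].
- apply: msmooth_eq (msmooth_cst _ 0) => // p _.
  by rewrite tnth_rshift tnth_mktuple linear0.
- apply: msmooth_eq (msmooth_cst _ 0) => // p _.
  by rewrite tnth_lshift tnth_mktuple linear0.
- apply: (@msmooth_eq _ _ _ _
    (fun p => coord (frame i.2 p) a (tnth (frame j.2 p) b))) => //.
    by move=> p _; rewrite tnth_rshift tnth_mktuple.
  by apply: sub_msmooth (frame_smooth a b) => p [[_ ?] [_ ?]].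
Qed.

Definition sum_bundle : vbundle M := {|
  fiber := sfiber;
  frame := sframe;
  tdom_open := sdom_open;
  tdom_cover := sdom_cover;
  frame_basis := sframe_basis;
  frame_smooth := sframe_smooth
|}.

Fact pair_sec_subproof (x : section E) (u : section F) (i : triv sum_bundle)
    (a : 'I_(trank i)) :
  msmooth (tdom i) (fun p => coord (frame i p) a ((x p, u p) : sum_bundle p)).
Proof.
apply: (@msmooth_eq _ _ _ _ (fun p =>
    sum_coord (frame i.1 p) (frame i.2 p) a (x p, u p))).
- exact: sdom_open.
- by move=> p ip; rewrite -sframe_coord.
rewrite /sum_coord; case: (split_ordP a) => {}a _ /=.
  by apply: sub_msmooth (sec_smooth x a) => p [].
by apply: sub_msmooth (sec_smooth u a) => p [].
Qed.

Definition pair_sec x u : section sum_bundle := MkSection (pair_sec_subproof x u).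

Fact fst_sec_subproof (X : section sum_bundle) i (a : 'I_(trank i)) :
  msmooth (tdom i) (fun p => coord (frame i p) a (X p : (E p * F p)%type).1).
Proof.
apply: (@sub_msmooth _ _ _ _ (\bigcup_j (tdom i `&` @tdom _ _ _ F j))).
  by move=> p ip; have [j jp] := tdom_cover F p; exists j.
move=> c k; apply: (@sub_Ck _ _ _ _
  (\bigcup_j (cmap c @` (cdom c `&` (tdom i `&` @tdom _ _ _ F j))))).
  by move=> x [p [cp [j _ ijp]] <-]; exists j => //; exists p.
apply: Ck_bigcup => j; move: c k.
apply: msmooth_eq (sec_smooth X (lshift (trank j) a : 'I_(@trank _ _ _ sum_bundle (i, j)))).
  exact: (sdom_open (i, j)).
move=> p ijp; rewrite [LHS](sframe_coord _ _ ijp) /sum_coord.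
by rewrite (unsplitK (inl a)).
Qed.

Definition fst_sec X : section E := MkSection (fst_sec_subproof X).

Fact snd_sec_subproof (X : section sum_bundle) j (a : 'I_(trank j)) :
  msmooth (tdom j) (fun p => coord (frame j p) a (X p : (E p * F p)%type).2).
Proof.
move=> c k; apply: (@sub_Ck _ _ _ _
  (\bigcup_i (cmap c @` (cdom c `&` (@tdom _ _ _ E i `&` tdom j))))).
  move=> x [p [cp jp] <-]; have [i ip] := tdom_cover E p.
  by exists i => //; exists p.
apply: Ck_bigcup => i; move: c k.
apply: msmooth_eq (sec_smooth X (rshift (trank i) a : 'I_(@trank _ _ _ sum_bundle (i, j)))).
  exact: (sdom_open (i, j)).
move=> p ijp; rewrite [LHS](sframe_coord _ _ ijp) /sum_coord.
by rewrite (unsplitK (inr a)).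
Qed.

Definition snd_sec X : section F := MkSection (snd_sec_subproof X).

End DirectSum.

(* T_pM is the space of derivations of C^oo(M) at p. *)
Record tangent (R : realType) (n : nat) (M : manifold R n) (p : M) := Tangent {
  tan_fun :> cinf M -> R;
  tan_linear : forall (k : R) (f g : cinf M),
    tan_fun (cinf_cst M k * f + g) = k * tan_fun f + tan_fun g;
  tan_leibniz : forall f g : cinf M,
    tan_fun (f * g) = f p * tan_fun g + g p * tan_fun f
}.

(* Bundle maps E -> TM over the identity of M. Smoothness: every smooth section
   x of E is sent to a smooth vector field, that is, one whose derivative of any
   smooth function is smooth. *)
Record tangent_map (R : realType) (n : nat) (M : manifold R n) (E : vbundle M) :=
  TangentMap {
    tmap :> forall p, E p -> tangent p;
    tmap_linear : forall p (k : R) (u v : E p) (f : cinf M),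
      tmap (k *: u + v) f = k * tmap u f + tmap v f;
    tmap_smooth : forall (x : section E) (f : cinf M),
      msmooth setT (fun p => tmap (x p) f)
  }.

Definition der (R : realType) (n : nat) (M : manifold R n) (E : vbundle M)
    (a : tangent_map E) (x : section E) (f : cinf M) : cinf M :=
  Cinf (tmap_smooth a x f).

Record lie_algebroid (R : realType) (n : nat) (M : manifold R n) (B : vbundle M) :=
  LieAlgebroid {
    bracket : section B -> section B -> section B;
    lanchor : tangent_map B;
    bracket_linearl : forall (k : R) x y z,
      bracket (cinf_cst M k *: x + y) z =
        cinf_cst M k *: bracket x z + bracket y z;
    bracket_anti : forall x y, bracket x y = - bracket y x;
    bracket_jacobi : forall x y z,
      bracket x (bracket y z) + bracket y (bracket z x) +
        bracket z (bracket x y) = 0;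
    bracket_leibniz : forall x (f : cinf M) y,
      bracket x (f *: y) = f *: bracket x y + der lanchor x f *: y
  }.

Record left_symmetric_algebroid (R : realType) (n : nat) (M : manifold R n)
    (A : vbundle M) := LeftSymmetricAlgebroid {
  lprod : section A -> section A -> section A;
  sanchor : tangent_map A;
  lprod_linearl : forall (k : R) x y z,
    lprod (cinf_cst M k *: x + y) z = cinf_cst M k *: lprod x z + lprod y z;
  lprod_linearr : forall (k : R) x y z,
    lprod x (cinf_cst M k *: y + z) = cinf_cst M k *: lprod x y + lprod x z;
  lprod_left_symmetric : forall x y z,
    lprod (lprod x y) z - lprod x (lprod y z) =
      lprod (lprod y x) z - lprod y (lprod x z);
  lprod_leibniz : forall x (f : cinf M) y,
    lprod x (f *: y) = f *: lprod x y + der sanchor x f *: y;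
  lprod_tensorial : forall (f : cinf M) x y,
    lprod (f *: x) y = f *: lprod x y
}.

Section SubAdjacent.
Context {R : realType} {n : nat} {M : manifold R n} {A : vbundle M}.
Variable S : left_symmetric_algebroid A.
Implicit Types (x y z : section A) (f : cinf M).

Definition commutator x y : section A := lprod S x y - lprod S y x.

Fact lprodDl x y z : lprod S (x + y) z = lprod S x z + lprod S y z.
Proof.
have := lprod_linearl S 1 x y z.
by rewrite -[cinf_cst M 1]/(1 : cinf M) !scale1r.
Qed.

Fact lprodDr x y z : lprod S x (y + z) = lprod S x y + lprod S x z.
Proof.
have := lprod_linearr S 1 x y z.
by rewrite -[cinf_cst M 1]/(1 : cinf M) !scale1r.
Qed.

Fact lprodNl x y : lprod S (- x) y = - lprod S x y.
Proof. by rewrite -scaleN1r lprod_tensorial scaleN1r. Qed.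

Fact lprod0r x : lprod S x 0 = 0.
Proof. by apply: (@addrI _ (lprod S x 0)); rewrite -lprodDr !addr0. Qed.

Fact lprodNr x y : lprod S x (- y) = - lprod S x y.
Proof. by apply: (@addrI _ (lprod S x y)); rewrite -lprodDr !subrr lprod0r. Qed.

Fact commutator_linearl (k : R) x y z :
  commutator (cinf_cst M k *: x + y) z =
    cinf_cst M k *: commutator x z + commutator y z.
Proof.
by rewrite /commutator lprod_linearl lprod_linearr scalerBr opprD addrACA.
Qed.

Fact commutator_anti x y : commutator x y = - commutator y x.
Proof. by rewrite /commutator opprB. Qed.

Fact commutator_jacobi x y z :
  commutator x (commutator y z) + commutator y (commutator z x) +
    commutator z (commutator x y) = 0.
Proof.
have ls u v w : lprod S (lprod S u v) w - lprod S (lprod S v u) w =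
    lprod S u (lprod S v w) - lprod S v (lprod S u w).
  have /eqP := lprod_left_symmetric S u v w.
  rewrite subr_eq addrC addrA addrAC => /eqP ->.
  by rewrite addrK.
have com u v w : commutator u (commutator v w) =
    lprod S u (lprod S v w) - lprod S u (lprod S w v)
    - (lprod S v (lprod S w u) - lprod S w (lprod S v u)).
  by rewrite -ls /commutator !lprodDr !lprodDl !lprodNr !lprodNl.
have sub2 (a b c d : section A) : a - b - (c - d) = (a + d) - (b + c).
  by rewrite opprB addrACA opprD.
have subK (a b c : section A) : a - b + (b - c) = a - c by rewrite addrA subrK.
rewrite !com !sub2 [X in _ + (_ - X) + _]addrC [X in (_ - X) + _ + _]addrC.
rewrite [X in _ + (_ - X)]addrC !subK.
by rewrite [X in _ + (X - _)]addrC subK [X in X - _]addrC subrr.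
Qed.

Fact commutator_leibniz x f y :
  commutator x (f *: y) = f *: commutator x y + der (sanchor S) x f *: y.
Proof.
by rewrite /commutator lprod_leibniz lprod_tensorial scalerBr addrAC.
Qed.

Definition sub_adjacent : lie_algebroid A := LieAlgebroid
  commutator_linearl commutator_anti commutator_jacobi commutator_leibniz.

End SubAdjacent.

(* The representation of B on the dual bundle of E attached to a representation
   rho of B on E: [dual_rep a rho x xi] is the section determined by
   <rho^*_x xi, y> = a(x) <xi, y> - <xi, rho_x y> for all sections y. *)
Definition dual_rep (R : realType) (n : nat) (M : manifold R n) (B E : vbundle M)
    (a : tangent_map B) (rho : section B -> section E -> section E)
    (x : section B) (xi : section (dual_bundle E)) : section (dual_bundle E) :=
  xget 0 [set eta : section (dual_bundle E) | forall y : section E,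
    pairing eta y = der a x (pairing xi y) - pairing xi (rho x y)].

Section SemidirectProduct.
Context {R : realType} {n : nat} {M : manifold R n} {B E : vbundle M}.

Definition semidirect_bracket (L : lie_algebroid B)
    (rho : section B -> section E -> section E) (X Y : section (sum_bundle B E)) :
    section (sum_bundle B E) :=
  pair_sec (bracket L (fst_sec X) (fst_sec Y))
    (rho (fst_sec X) (snd_sec Y) - rho (fst_sec Y) (snd_sec X)).

Lemma semidirect_bracketE L rho (x y : section B) (u v : section E) :
  semidirect_bracket L rho (pair_sec x u) (pair_sec y v) =
    pair_sec (bracket L x y) (rho x v - rho y u).
Proof.
rewrite /semidirect_bracket.
have -> : fst_sec (pair_sec x u) = x by exact: section_ext.
have -> : snd_sec (pair_sec x u) = u by exact: section_ext.
have -> : fst_sec (pair_sec y v) = y by exact: section_ext.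
by have -> : snd_sec (pair_sec y v) = v by exact: section_ext.
Qed.

Let sanc (a : tangent_map B) p (u : sum_bundle B E p) : tangent p := a p u.1.

Fact semidirect_anchor_linear (a : tangent_map B) p (k : R) (u v : sum_bundle B E p) f :
  sanc a (k *: u + v) f = k * sanc a u f + sanc a v f.
Proof. exact: tmap_linear. Qed.

Fact semidirect_anchor_smooth (a : tangent_map B) (X : section (sum_bundle B E)) f :
  msmooth setT (fun p => sanc a (X p) f).
Proof. exact: (tmap_smooth a (fst_sec X) f). Qed.

Definition semidirect_anchor (a : tangent_map B) : tangent_map (sum_bundle B E) :=
  TangentMap (semidirect_anchor_linear a) (semidirect_anchor_smooth a).

Definition is_semidirect_product (L : lie_algebroid B)
    (rho : section B -> section E -> section E) (P : lie_algebroid (sum_bundle B E)) :=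
  bracket P = semidirect_bracket L rho /\ lanchor P = semidirect_anchor (lanchor L).

End SemidirectProduct.

(* A smooth section of Lambda^2 E^*; smoothness is tested on smooth sections. *)
Record two_form (R : realType) (n : nat) (M : manifold R n) (E : vbundle M) :=
  TwoForm {
    form :> forall p, E p -> E p -> R;
    form_linearl : forall p (k : R) (u v w : E p),
      form (k *: u + v) w = k * form u w + form v w;
    form_anti : forall p (u v : E p), form u v = - form v u;
    form_smooth : forall x y : section E, msmooth setT (fun p => form (x p) (y p))
  }.

Section Forms.
Context {R : realType} {n : nat} {M : manifold R n} {E : vbundle M}.

Definition form_eval (w : two_form E) (x y : section E) : cinf M :=
  Cinf (form_smooth w x y).

Definition nondegenerate_form (w : two_form E) :=
  forall p (u : E p), (forall v : E p, w p u v = 0) -> u = 0.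

Definition differential (L : lie_algebroid E) (w : two_form E)
    (x y z : section E) : cinf M :=
  der (lanchor L) x (form_eval w y z) - der (lanchor L) y (form_eval w x z)
  + der (lanchor L) z (form_eval w x y) - form_eval w (bracket L x y) z
  + form_eval w (bracket L x z) y - form_eval w (bracket L y z) x.

Definition closed_form (L : lie_algebroid E) (w : two_form E) :=
  forall x y z, differential L w x y z = 0.

End Forms.

Section PhaseSpace.
Context {R : realType} {n : nat} {M : manifold R n} (B : vbundle M).

Let nform (p : M) (u v : sum_bundle B (dual_bundle B) p) : R := v.2 u.1 - u.2 v.1.

Fact natural_form_linearl p (k : R) (u v w : sum_bundle B (dual_bundle B) p) :
  nform (k *: u + v) w = k * nform u w + nform v w.
Proof.
rewrite /nform /= linearP /= add_lfunE scale_lfunE /=.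
by rewrite mulrBr opprD addrACA.
Qed.

Fact natural_form_anti p (u v : sum_bundle B (dual_bundle B) p) : nform u v = - nform v u.
Proof. by rewrite /nform opprB. Qed.

Fact natural_form_smooth (X Y : section (sum_bundle B (dual_bundle B))) :
  msmooth setT (fun p => nform (X p) (Y p)).
Proof.
have := cinfP (pairing (snd_sec Y) (fst_sec X) - pairing (snd_sec X) (fst_sec Y)).
by apply: msmooth_eq; [exact: openT|move=> p _; rewrite cinfD cinfN].
Qed.

Definition natural_form : two_form (sum_bundle B (dual_bundle B)) :=
  TwoForm natural_form_linearl natural_form_anti natural_form_smooth.

Lemma natural_formE (x y : section B) (xi eta : section (dual_bundle B)) :
  form_eval natural_form (pair_sec x xi) (pair_sec y eta) =
    pairing eta x - pairing xi y.
Proof. by apply: cinf_ext => p; rewrite cinfD cinfN. Qed.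

(* The first two clauses say that B, with its structure L, is a Lie subalgebroid
   of P, and the next two that the dual bundle is one for the structure L'. *)
Definition is_phase_space (L : lie_algebroid B)
    (P : lie_algebroid (sum_bundle B (dual_bundle B))) :=
  exists L' : lie_algebroid (dual_bundle B),
    [/\ (forall x y : section B,
          bracket P (pair_sec x 0) (pair_sec y 0) = pair_sec (bracket L x y) 0),
        (forall p (u : B p), lanchor P p (u, 0) = lanchor L p u),
        (forall xi eta : section (dual_bundle B),
          bracket P (pair_sec 0 xi) (pair_sec 0 eta) =
            pair_sec 0 (bracket L' xi eta)),
        (forall p (phi : dual_bundle B p), lanchor P p (0, phi) = lanchor L' p phi) &
        closed_form P natural_form].

End PhaseSpace.

Definition dual_left_mult (R : realType) (n : nat) (M : manifold R n)
    (A : vbundle M) (S : left_symmetric_algebroid A) :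
    section A -> section (dual_bundle A) -> section (dual_bundle A) :=
  dual_rep (lanchor (sub_adjacent S)) (lprod S).

(* Main.v *)
From HB Require Import structures.
Require Import Defs.
From mathcomp Require Import all_boot all_order all_algebra.
From mathcomp Require Import all_classical all_reals all_analysis.
From mathcomp Require Import ring lra.

(* Two facts need work beyond the algebra. The sections [L*_x xi] are determined
   only through the pairing, so one has to know that a C^oo(M)-linear map from
   sections of A to C^oo(M) is the pairing with a section of A^*; bump functions
   make such a map pointwise and its values smooth. And the anchor preserves
   brackets, by the Jacobi identity for [x], [y], [f *: z]; with left symmetry this
   makes L^* a representation, whence the Jacobi identity of the semidirect product.
   In d omega the anchor terms and the product terms then cancel identically, by the
   formula for L^*. The dual bundle carries the zero bracket and the zero anchor. *)

Set Implicit Arguments.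
Unset Strict Implicit.
Unset Printing Implicit Defensive.

Import Order.TTheory GRing.Theory Num.Theory.
Import numFieldNormedType.Exports.

Local Open Scope classical_set_scope.
Local Open Scope ring_scope.

(** * Flat functions of one real variable *)

Section FlatFunction.
Context {R : realType}.

(* The functions [t^-m exp (-1/t)] are closed under differentiation up to linear
   combinations, which makes the smoothness of [flat 0] an easy induction. *)
Definition flat (m : nat) (t : R) : R :=
  if 0 < t then (t^-1) ^+ m * expR (- t^-1) else 0.

Lemma flat_gt0 m t : 0 < t -> 0 < flat m t.
Proof. by move=> t0; rewrite /flat t0 mulr_gt0 ?expR_gt0 ?exprn_gt0 ?invr_gt0. Qed.

Lemma flat_le0 m t : t <= 0 -> flat m t = 0.
Proof. by rewrite /flat leNgt => /negbTE ->. Qed.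

(** With s = 1/t, the exponential series gives s^(m+2) <= (m+2)! e^s. A bound quadratic in [t] is
    what forces the derivative at 0 to vanish. *)
Lemma flat_bound m t : `|flat m t| <= (m.+2)`!%:R * t ^+ 2.
Proof.
have [t0|t0] := ltP 0 t; last first.
  by rewrite flat_le0 // normr0 mulr_ge0 ?sqr_ge0.
rewrite gtr0_norm ?flat_gt0 // /flat t0 /= expRN.
have s0 : 0 < t^-1 by rewrite invr_gt0.
have -> : t ^+ 2 = t^-1 ^- 2 by rewrite exprVn invrK.
set s := t^-1 in s0 *.
rewrite ler_pdivrMr ?expR_gt0 //.
have F : (0 : R) < (m.+2)`!%:R by rewrite ltr0n fact_gt0.
have es : s ^+ m.+2 <= expR s * (m.+2)`!%:R.
  rewrite -ler_pdivrMr //; apply: le_trans (expR_ge1Dxn m.+1 (ltW s0)).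
  by rewrite lerDr.
rewrite mulrAC -[leRHS]/(_ * _ / s ^+ 2) ler_pdivlMr ?exprn_gt0 // -exprD addn2.
by rewrite mulrC.
Qed.

(** For t > 0 put s = 1/t, so s' = -s^2, and differentiate s^m e^-s. For t < 0 the function is
    locally zero. *)
Lemma is_derive_flat (m : nat) (t : R) :
  is_derive t 1 (flat m) (flat m.+2 t - m%:R * flat m.+1 t).
Proof.
have [t0|t0|->] := ltgtP t 0.
- have E : \near t, cst 0 t = flat m t.
    by near=> s; rewrite flat_le0 // ltW //; near: s; exact: lt_nbhsl.
  rewrite !(flat_le0 _ (ltW t0)) mulr0 subr0.
  by apply: (near_eq_is_derive E); exact: is_derive_cst.
- have E : \near t, (fun t => (t^-1) ^+ m * expR (- t^-1)) t = flat m t.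
    by near=> s; rewrite /flat ifT //; near: s; exact: (open_nbhs_nbhs (conj (@open_gt _ (0 : R)) t0)).
  have tn0 : t != 0 by rewrite gt_eqF.
  apply: (near_eq_is_derive E); rewrite /flat t0 /=.
  have dV : is_derive t 1 (fun t : R => t^-1) (- t ^- 2).
    by apply: is_derive_eq (is_deriveV tn0 (is_derive_id t 1)) _;
      rewrite /GRing.scale /= mulr1.
  have dX := is_deriveX m dV.
  have dE := @is_derive1_comp R expR (- (fun t => t^-1)) t _ _
    (is_derive_expR (- t^-1)) (is_deriveN dV).
  have -> : (fun t : R => t^-1 ^+ m * expR (- t^-1)) =
      (fun t => t^-1) ^+ m * (expR \o - (fun t => t^-1)).
    by apply/funext => s; rewrite /= fctE exprfctE.
  apply: is_derive_eq (is_deriveM dX dE) _.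
  rewrite exprfctE /GRing.scale /= opprK -[t ^- 2]exprVn.
  rewrite -[(- _) t]/(- t^-1); move: t^-1 (expR _) => s e.
  by case: (m) => [|k] /=; rewrite ?exprS; ring.
- rewrite !flat_le0 // mulr0 subr0.
  (* By [flat_bound] the difference quotient at 0 is at most (m+2)! |h|. *)
  have C : h^-1 *: ((flat m \o shift 0) (h *: 1) - flat m 0) @[h --> 0^'] --> (0 : R).
    apply/cvgr0Pnorm_le => e e0.
    have F : (0 : R) < (m.+2)`!%:R by rewrite ltr0n fact_gt0.
    near=> h.
    have h0 : h != 0 by near: h; exact: nbhs_dnbhs_neq.
    rewrite [flat m 0]flat_le0 // subr0 /= addr0 [h *: 1]mulr1 normrM normfV.
    rewrite ler_pdivrMl ?normr_gt0 //; apply: le_trans (flat_bound m h) _.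
    rewrite -normr_id -real_normK ?num_real // normr_id expr2 mulrCA.
    rewrite ler_wpM2l // -ler_pdivlMl //.
    near: h; apply: dnbhs0_le; by rewrite mulr_gt0 ?invr_gt0.
  split; first by apply/cvg_ex; exists 0.
  exact: cvg_lim.
Unshelve. all: by end_near. Qed.
End FlatFunction.

(** * Closure properties of C^k functions on open sets *)

Section CkClosure.
Context {R : realType} {n : nat}.
Implicit Types (U : set 'rV[R]_n) (f g : 'rV[R]_n -> R).

(** The derivative involves [flat m.+1] and [flat m.+2], so the induction on [k] must run over all
    [m] at once. *)
Lemma Ck_flat k U g m : open U -> Ck k U g -> Ck k U (flat m \o g).
Proof.
move=> oU; elim: k g m => [|k IH] g m.
  move=> cg x Ux; apply: continuous_comp; first exact: cg.
  apply/differentiable_continuous/derivable1_diffP.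
  by have [] := is_derive_flat m (g x).
move=> Cg; have Cg' := CkS Cg; case: Cg => dg Dg.
have dh t : differentiable (flat m : R -> R) t.
  by apply/derivable1_diffP; have [] := is_derive_flat m t.
split=> [x Ux|v]; first by apply: differentiable_comp; [exact: dg|exact: dh].
pose h x := ((flat m.+2 \o g) x + - m%:R * (flat m.+1 \o g) x) * 'D_v g x.
apply: (@Ck_eq _ _ _ _ h) => //.
  move=> x /set_mem Ux; have dgx := dg _ Ux.
  have dc : differentiable (flat m \o g) x by exact: differentiable_comp.
  rewrite [RHS]deriveE // (diff_comp dgx (dh _)) /= [in RHS]diff1E // derive1E.
  rewrite /h (@derive_val _ _ _ _ _ _ _ (is_derive_flat m (g x))) -deriveE //.
  by rewrite mulNr; exact: mulrC.
have Cm2 : Ck k U (flat m.+2 \o g) by exact: IH.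
have Cm1 : Ck k U (flat m.+1 \o g) by exact: IH.
exact: CkM oU (CkD oU Cm2 (CkM oU (Ck_cst k U (- m%:R)) Cm1)) (Dg v).
Qed.

(** The induction closes because D_v (1/g) = - (1/g)^2 D_v g is again a product of C^k functions. *)
Lemma CkV k U g : open U -> (forall x, U x -> g x != 0) -> Ck k U g ->
  Ck k U (fun x => (g x)^-1).
Proof.
move=> oU g0; elim: k => [|k IH].
  by move=> cg x Ux; apply: continuousV; [exact: g0|exact: cg].
move=> Cg; have Cg' := IH (CkS Cg); case: Cg => dg Dg.
split=> [x Ux|v]; first by apply: differentiableV; [exact: dg|exact: g0].
apply: (@Ck_eq _ _ _ _ (fun x => -1 * ((g x)^-1 * (g x)^-1 * 'D_v g x))) => //.
  move=> x /set_mem Ux; rewrite deriveV; [|exact: g0|exact/diff_derivable/dg].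
  by rewrite mulN1r -mulNr -invfM -expr2.
exact: CkM oU (Ck_cst k U (-1)) (CkM oU (CkM oU Cg' Cg') (Dg v)).
Qed.

Lemma Ck_prod k U (I : Type) (s : seq I) (F : I -> 'rV[R]_n -> R) :
  open U -> (forall i, Ck k U (F i)) -> Ck k U (fun x => \prod_(i <- s) F i x).
Proof.
move=> oU sF; elim: s => [|i s IH].
  by apply: Ck_eq (Ck_cst k U 1) => // x _; rewrite big_nil.
by apply: Ck_eq (CkM oU (sF i) IH) => // x _; rewrite big_cons.
Qed.

End CkClosure.

(** * Bump functions and cut-offs on a manifold *)

Section ManifoldFunctions.
Context {R : realType} {n : nat} {M : manifold R n}.
Implicit Types (V W C : set M) (f g : M -> R).

Lemma msmooth_bigcup (I : Type) (W : I -> set M) f :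
  (forall i, msmooth (W i) f) -> msmooth (\bigcup_i W i) f.
Proof.
move=> sf c k.
apply: (@sub_Ck _ _ _ _ (\bigcup_i (cmap c @` (cdom c `&` W i)))).
  by move=> x [p [cp [i _ Wp]] <-]; exists i => //; exists p.
by apply: Ck_bigcup => i; exact: sf.
Qed.

Lemma msmoothU V W f : msmooth V f -> msmooth W f -> msmooth (V `|` W) f.
Proof.
move=> sV sW; rewrite -bigcup2E.
(* [bigcup2] continues the pair by empty sets, on which [Ck] holds vacuously. *)
by apply: (@msmooth_bigcup nat (bigcup2 V W)) => -[|[|i]] //= c k; rewrite setI0 image_set0;
  elim: k (f \o cinv c) => /= [g ? []|k IH g]; split=> // x [].
Qed.

Lemma msmoothV W f : open W -> (forall p, W p -> f p != 0) -> msmooth W f ->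
  msmooth W (fun p => (f p)^-1).
Proof.
move=> oW f0 sf c k; apply: CkV (sf c k); first exact: cimgI_open.
by move=> x [p [cp Wp] <-] /=; rewrite cmapK // f0.
Qed.

Lemma msmooth_flat W m f : open W -> msmooth W f -> msmooth W (flat m \o f).
Proof. by move=> oW sf c k; apply: Ck_flat (sf c k); exact: cimgI_open. Qed.

Lemma msmooth_prod W (I : Type) (s : seq I) (F : I -> M -> R) : open W ->
  (forall i, msmooth W (F i)) -> msmooth W (fun p => \prod_(i <- s) F i p).
Proof.
move=> oW sF c k.
by apply: (Ck_prod _ (F := fun i => F i \o cinv c) (cimgI_open oW)) => i; exact: sF.
Qed.

Lemma msmooth_cmap (c : chart M) k : msmooth (cdom c) (fun p => cmap c p ord0 k).
Proof. by move=> d; exact: chart_smooth. Qed.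

Definition supported_in C (f : M -> R) := forall p, ~ C p -> f p = 0.

(** In a chart, multiply [flat 0] of r^2 - (x_i - x0_i)^2 over all coordinates on a closed cube
    about the point, and extend by zero. *)
Lemma bump W p : open W -> W p ->
  exists C (chi : cinf M), [/\ closed C, C `<=` W, supported_in C chi & chi p != 0].
Proof.
move=> oW Wp; have [c cp] := cdom_cover p.
set x0 := cmap c p; set U := cmap c @` (cdom c `&` W).
have nU : nbhs x0 U.
  by apply: open_nbhs_nbhs; split; [exact: cimgI_open|exists p].
have /nbhs_ballP[e /= e0 eU] := nU.
(* Halving keeps the closed cube inside the open sup-norm ball of radius [e]. *)
pose r := e / 2; have r0 : 0 < r by rewrite divr_gt0.
pose Q := [set x : 'rV[R]_n | forall i, `[x0 ord0 i - r, x0 ord0 i + r]%classic (x ord0 i)].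
have QE x : Q x <-> forall i, `|x ord0 i - x0 ord0 i| <= r.
  by split=> H i; have := H i; rewrite /= in_itv /= ler_distl.
have QU : Q `<=` U.
  move=> x /QE Qx; apply: eU; split=> // i j; rewrite ord1 /ball /= distrC.
  by apply: le_lt_trans (Qx j) _; rewrite /r; lra.
have cQ : compact Q.
  apply: (@rV_compact _ _ (fun i => `[x0 ord0 i - r, x0 ord0 i + r]%classic)) => i.
  exact: segment_compact.
pose K := cinv c @` Q.
have KE q : K q -> (cdom c `&` W) q.
  by move=> [x Qx <-]; have [q' [cq' Wq'] <-] := QU _ Qx; rewrite cmapK.
(* The image of the compact cube is compact, hence closed as [M] is Hausdorff. *)
have clK : closed K.
  apply: compact_closed; first exact: mhausdorff.
  apply: continuous_compact => //; apply: continuous_in_subspaceT => x /set_mem Qx.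
  apply: cinv_cont; have [q [cq _] <-] := QU _ Qx; by exists q.
pose F q := \prod_(i < n) (flat 0 \o
  (fun q => r ^+ 2 - (cmap c q ord0 i - x0 ord0 i) ^+ 2)) q.
pose chi q := if pselect (K q) then F q else 0.
have sF : msmooth (cdom c) F.
  apply: msmooth_prod => [|i]; first exact: cdom_open.
  apply: msmooth_flat; first exact: cdom_open.
  have oc := cdom_open c.
  have s1 : msmooth (cdom c) (fun q => cmap c q ord0 i + - x0 ord0 i).
    apply: (msmoothD oc); [exact: msmooth_cmap|exact: msmooth_cst].
  have := msmoothD oc (msmooth_cst _ (r ^+ 2))
    (msmoothM oc (msmooth_cst _ (-1)) (msmoothM oc s1 s1)).
  by apply: msmooth_eq => // q _; rewrite mulN1r expr2.
have schi : msmooth setT chi.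
  (* Two open sets cover [M]: on the first [chi] equals [F], on the second it is zero. *)
  have -> : setT = cdom c `|` ~` K.
    apply/esym/seteqP; split=> // q _.
    by have [/KE[]|] := pselect (K q); [left|right].
  apply: msmoothU; last first.
    apply: msmooth_eq (msmooth_cst _ 0); first exact: closed_openC.
    by move=> q nK; rewrite /chi; case: pselect.
  apply: msmooth_eq sF; first exact: cdom_open.
  move=> q cq; rewrite /chi; case: pselect => // nK.
  have : ~ Q (cmap c q) by move=> Qq; apply: nK; exists (cmap c q) => //; rewrite cmapK.
  (* Outside the cube some coordinate is farther than [r] from the centre, so its factor, and with
     it [F], is already zero. *)
  move=> /QE /existsNP[i] /negP; rewrite -ltNge => ri.
  rewrite /F (bigD1 i) //= flat_le0 ?mul0r // subr_le0.
  by rewrite -[leRHS]real_normK ?num_real // lerXn2r ?nnegrE ?ltW // (lt_trans r0).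
exists K, (Cinf schi); split=> // [q /KE[]//|q|] /=; rewrite /chi.
  by case: pselect.
have Kp : K p by exists x0; [apply/QE => i; rewrite subrr normr0 ltW|rewrite /x0 cmapK].
case: pselect => // ?; rewrite gt_eqF // prodr_gt0 // => i _ /=.
by rewrite flat_gt0 // subrr expr0n subr0 exprn_gt0.
Qed.

(** On V minus C the product is zero, so [f] may be arbitrary outside [W], as frame coordinates are
    outside the domain of the frame. *)
Lemma msmooth_cutoff V W C (chi : cinf M) f : open V -> open W -> closed C ->
  C `<=` W -> supported_in C chi -> msmooth (V `&` W) f ->
  msmooth V (fun p => chi p * f p).
Proof.
move=> oV oW clC CW sC sf.
have -> : V = (V `&` W) `|` (V `&` ~` C).
  apply/seteqP; split=> [p Vp|p [[]|[]] //].
  by have [/CW|] := pselect (C p); [left|right].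
apply: msmoothU.
  apply: msmoothM => //; first exact: openI.
  exact: sub_msmooth (cinfP chi).
apply: msmooth_eq (msmooth_cst _ 0).
  by apply: openI => //; exact: closed_openC.
by move=> p [_ /sC ->]; rewrite mul0r.
Qed.

Lemma cinf_continuous (f : cinf M) : continuous f.
Proof.
move=> p; have [c cp] := cdom_cover p.
have E : \near p, ((f \o cinv c) \o cmap c) p = f p.
  apply: filterS (open_nbhs_nbhs (conj (cdom_open c) cp)) => q cq.
  by rewrite /= cmapK.
rewrite /continuous_at -(nbhs_singleton E); apply: cvg_trans (near_eq_cvg E) _.
apply: continuous_comp; first exact: cmap_cont.
by apply: (cinfP f c 0%N); exists p.
Qed.

Lemma cinf_neq0_open (f : cinf M) : open [set p | f p != 0].
Proof.
apply: (@open_comp _ _ f [set x | x != 0]); last exact: open_neq.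
by move=> p _; exact: cinf_continuous.
Qed.

End ManifoldFunctions.

(** * Global sections from local frames *)

Section Sections.
Context {R : realType} {n : nat} {M : manifold R n} {E : vbundle M}.
Implicit Types (x y : section E) (f : cinf M).

Lemma sec_sum (I : Type) (s : seq I) (F : I -> section E) p :
  (\sum_(i <- s) F i) p = \sum_(i <- s) F i p.
Proof. by elim/big_rec2: _ => // i u v _ <-. Qed.

(** The expansion of a section in a local frame becomes global after multiplication by chi^2: one
    factor [chi] cuts off the coefficients, the other the frame vectors. *)
Lemma cutoff_frame (i : triv E) p : tdom i p ->
  exists (chi : cinf M) (e : 'I_(trank i) -> section E), [/\ chi p != 0,
    forall a q, e a q = chi q *: tnth (frame i q) a &
    forall y, exists f : 'I_(trank i) -> cinf M,
      (forall a q, f a q = chi q * coord (frame i q) a (y q)) /\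
      (chi * chi) *: y = \sum_a f a *: e a].
Proof.
move=> ip; have [C [chi [clC CW sC chip]]] := bump (tdom_open i) ip.
have se a j (b : 'I_(trank j)) : msmooth (tdom j)
    (fun q => coord (frame j q) b (chi q *: tnth (frame i q) a)).
  have := msmooth_cutoff (tdom_open j) (tdom_open i) clC CW sC (frame_smooth b a).
  by apply: msmooth_eq; [exact: tdom_open|move=> q _; rewrite linearZ].
have sf y a : msmooth setT (fun q => chi q * coord (frame i q) a (y q)).
  apply: (msmooth_cutoff openT (tdom_open i) clC CW sC); rewrite setTI.
  exact: sec_smooth.
exists chi, (fun a => MkSection (se a)); split=> // y.
exists (fun a => Cinf (sf y a)); split=> //; apply: section_ext => q.
(* Outside the domain the frame means nothing, but both sides vanish with [chi]. *)
rewrite sec_sum secZ cinfM; have [iq|niq] := pselect (tdom i q); last first.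
  rewrite sC; last by move/CW.
  by rewrite mul0r scale0r big1 // => a _; rewrite secZ /= sC ?mul0r ?scale0r // => /CW.
rewrite [y q in LHS](basis_sum (y q) (frame_basis iq)) scaler_sumr.
by apply: eq_bigr => a _; rewrite secZ /= !scalerA mulrAC.
Qed.

(** Constant coefficients suffice: the coordinates of [v] divided by [chi p], against the cut-off
    frame. *)
Lemma section_through p (v : E p) : exists x : section E, x p = v.
Proof.
have [i ip] := tdom_cover E p.
have [chi [e [chip eE _]]] := cutoff_frame ip.
exists (\sum_a cinf_cst M ((chi p)^-1 * coord (frame i p) a v) *: e a).
rewrite sec_sum [RHS](basis_sum v (frame_basis ip)); apply: eq_bigr => a _.
by rewrite secZ eE scalerA /= mulrAC mulVf // mul1r.
Qed.

(** Every vector is the value of a section, so pairings separate sections of the dual bundle.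
    Identities for [L^*] are checked this way. *)
Lemma pairing_inj (xi eta : section (dual_bundle E)) :
  (forall y : section E, pairing xi y = pairing eta y) -> xi = eta.
Proof.
move=> H; apply: section_ext => p; apply/lfunP => v.
have [y <-] := section_through v.
by have /(congr1 (fun f : cinf M => f p)) := H y.
Qed.

(** * C^oo(M)-linear maps on sections as pairings *)

Section Tensorial.
Variable T : section E -> cinf M.
Hypothesis TD : forall x y, T (x + y) = T x + T y.
Hypothesis TZ : forall f x, T (f *: x) = f * T x.

Let T0 : T 0 = 0.
Proof. by rewrite -(scale0r (0 : section E)) TZ mul0r. Qed.

Let cinf_sum (I : Type) (s : seq I) (F : I -> cinf M) p :
  (\sum_(i <- s) F i) p = \sum_(i <- s) F i p.
Proof. by elim/big_rec2: _ => // i u v _ <-. Qed.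

(** By linearity chi^2 T(x) is the sum of the f_a T(e_a), and each f_a vanishes at [p] with [x],
    while [chi] does not. *)
Lemma tensorial_local x p : x p = 0 -> T x p = 0.
Proof.
move=> xp; have [i ip] := tdom_cover E p.
have [chi [e [chip eE /(_ x)[f [fE Ef]]]]] := cutoff_frame ip.
have /(congr1 (fun f : cinf M => f p)) := congr1 T Ef.
rewrite TZ (big_morph T TD T0) cinf_sum big1 => [/eqP|a _].
  by rewrite !cinfM !mulf_eq0 (negbTE chip) /= => /eqP.
by rewrite TZ cinfM fE xp linear0 mulr0 mul0r.
Qed.

Lemma tensorial_pointwise x y p : x p = y p -> T x p = T y p.
Proof.
move=> xy; have : (x - y) p = 0 by rewrite secD secN xy subrr.
move/tensorial_local; rewrite TD -scaleN1r TZ cinfD cinfM cinfN cinf1 mulN1r.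
by move/eqP; rewrite subr_eq0 => /eqP.
Qed.

(** The functional at [p] sends [v] to the value at [p] of [T] on any section through [v]; by
    [tensorial_pointwise] the choice is immaterial. *)
Lemma tensorial_pairing : exists eta : section (dual_bundle E),
  forall y, pairing eta y = T y.
Proof.
pose lift p (v : E p) : section E := projT1 (cid (section_through v)).
have liftE p v : lift p v p = v by rewrite /lift; case: cid.
pose t p (v : E p) : R^o := T (lift p v) p.
have tE p x : t p (x p) = T x p by apply: tensorial_pointwise; rewrite liftE.
have tlin p : linear (t p).
  move=> k u v; have [x <-] := section_through u; have [y <-] := section_through v.
  rewrite !tE -[k]/(cinf_cst M k p) -secZ -secD tE TD TZ cinfD cinfM.
  by [].
pose tL p : {linear E p -> R^o} := HB.pack (t p) (GRing.isLinear.Build _ _ _ _ _ (tlin p)).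
pose eta p : dual_bundle E p := linfun (tL p).
have etaE p x : (eta p : 'Hom(E p, R^o)) (x p) = T x p by rewrite lfunE /= tE.
have seta i (a : 'I_(@trank _ _ _ (dual_bundle E) i)) :
    msmooth (tdom i) (fun p => coord (frame i p) a (eta p)).
  (* Near each point of the domain the frame vector is e / chi with [e] a global section, so the
     coordinate of [eta] is T(e) / chi there. *)
  have bp p : exists (chi : cinf M) (e : section E),
      (tdom i p -> chi p != 0) /\
      forall q, e q = chi q *: tnth (@frame _ _ _ E i q) a.
    have [ip|] := pselect (tdom i p); last first.
      (* Outside the domain a dummy choice is made; [chi] = 0 makes its nonvanishing set empty. *)
      by exists 0, 0; split=> // q; rewrite sec0 cinf0 scale0r.
    by have [chi [e [chip eE _]]] := @cutoff_frame i p ip; exists chi, (e a).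
  have [chi {}bp] := choice bp.
  apply: (@sub_msmooth _ _ _ _ (\bigcup_p (tdom i `&` [set q | chi p q != 0]))).
    by move=> p ip; exists p => //; split=> //=; have [e [/(_ ip)]] := bp p.
  apply: msmooth_bigcup => p; have [e [_ eE]] := bp p.
  have oI : open (tdom i `&` [set q | chi p q != 0]).
    by apply: openI; [exact: tdom_open|exact: cinf_neq0_open].
  have sV : msmooth (tdom i `&` [set q | chi p q != 0]) (fun q => (chi p q)^-1).
    by apply: msmoothV => // [q []//|]; exact: sub_msmooth (cinfP (chi p)).
  have sT : msmooth (tdom i `&` [set q | chi p q != 0]) (T e).
    exact: sub_msmooth (cinfP (T e)).
  apply: msmooth_eq (msmoothM oI sV sT) => // q [iq /= q0].
  rewrite [RHS](dual_tupleP (@frame_basis _ _ _ E i q iq)).2 -etaE eE linearZ /=.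
  exact: mulKf.
by exists (MkSection seta) => y; apply: cinf_ext => p; exact: etaE.
Qed.

End Tensorial.
End Sections.

(** * Rules for anchors and pairings; the anchor preserves brackets *)

Section Anchors.
Context {R : realType} {n : nat} {M : manifold R n} {E : vbundle M}.
Implicit Types (a : tangent_map E) (x y z : section E) (f g : cinf M).

Lemma derZD a x (k : R) f g :
  der a x (cinf_cst M k * f + g) = cinf_cst M k * der a x f + der a x g.
Proof. by apply: cinf_ext => p /=; rewrite tan_linear. Qed.

Lemma derD a x f g : der a x (f + g) = der a x f + der a x g.
Proof. by have := derZD a x 1 f g; rewrite -[cinf_cst M 1]/(1 : cinf M) !mul1r. Qed.

Lemma derB a x f g : der a x (f - g) = der a x f - der a x g.
Proof. by rewrite -[f in RHS](subrK g) [in RHS]derD addrK. Qed.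

Lemma derM a x f g : der a x (f * g) = f * der a x g + der a x f * g.
Proof. by apply: cinf_ext => p /=; rewrite tan_leibniz mulrC [X in _ + X]mulrC mulrC. Qed.

(** A derivation kills 1 = 1 * 1. Together with the Leibniz rule this gives the R-linearity of the
    semidirect bracket. *)
Lemma der_cst a x (k : R) : der a x (cinf_cst M k) = 0.
Proof.
have d0 : der a x 0 = 0 by apply: (addrI (der a x 0)); rewrite -derD !addr0.
have d1 : der a x 1 = 0.
  by apply: (addrI (der a x 1)); rewrite addr0 -{3}[1]mulr1 derM mul1r mulr1.
by have := derZD a x k 1 0; rewrite mulr1 addr0 d0 d1 mulr0 addr0.
Qed.

Lemma derDl a x y f : der a (x + y) f = der a x f + der a y f.
Proof.
by apply: cinf_ext => p /=; rewrite -[x p]scale1r tmap_linear mul1r scale1r.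
Qed.

Lemma tmap0 a p f : a p 0 f = 0.
Proof.
have := tmap_linear a 1 (0 : E p) 0 f; rewrite scaler0 addr0 mul1r => /eqP.
by rewrite -subr_eq subrr eq_sym => /eqP.
Qed.

Lemma derZl a f x g : der a (f *: x) g = f * der a x g.
Proof.
by apply: cinf_ext => p /=; rewrite -[_ *: _]addr0 tmap_linear tmap0 addr0.
Qed.

Lemma pairingDl (xi eta : section (dual_bundle E)) x :
  pairing (xi + eta) x = pairing xi x + pairing eta x.
Proof. by apply: cinf_ext => p /=; rewrite add_lfunE. Qed.

Lemma pairingZl f (xi : section (dual_bundle E)) x :
  pairing (f *: xi) x = f * pairing xi x.
Proof. by apply: cinf_ext => p /=; rewrite scale_lfunE. Qed.

Lemma pairingDr (xi : section (dual_bundle E)) x y :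
  pairing xi (x + y) = pairing xi x + pairing xi y.
Proof. by apply: cinf_ext => p /=; rewrite linearD. Qed.

Lemma pairingZr f (xi : section (dual_bundle E)) x :
  pairing xi (f *: x) = f * pairing xi x.
Proof. by apply: cinf_ext => p /=; rewrite linearZ. Qed.

Lemma pairingBl (xi eta : section (dual_bundle E)) x :
  pairing (xi - eta) x = pairing xi x - pairing eta x.
Proof. by rewrite pairingDl -scaleN1r pairingZl mulN1r. Qed.

Lemma pairingBr (xi : section (dual_bundle E)) x y :
  pairing xi (x - y) = pairing xi x - pairing xi y.
Proof. by rewrite pairingDr -scaleN1r pairingZr mulN1r. Qed.

Variable L : lie_algebroid E.

Lemma bracketDr x y z : bracket L x (y + z) = bracket L x y + bracket L x z.
Proof.
rewrite bracket_anti -[y]scale1r bracket_linearl opprD -bracket_anti.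
by rewrite scale1r [in RHS]bracket_anti scale1r.
Qed.

Lemma bracketNr x y : bracket L x (- y) = - bracket L x y.
Proof.
have b0 : bracket L x 0 = 0 by apply: (addrI (bracket L x 0)); rewrite -bracketDr !addr0.
by apply: (addrI (bracket L x y)); rewrite -bracketDr !subrr.
Qed.

(* Jacobi for [x], [y], [f *: z] and Leibniz give [c *: z = 0] for every [z], where
   [c] is the difference of both sides. At a point where [c] does not vanish all
   sections do, and then so does [c]. *)
Lemma anchor_bracket x y f : der (lanchor L) (bracket L x y) f =
  der (lanchor L) x (der (lanchor L) y f) - der (lanchor L) y (der (lanchor L) x f).
Proof.
set a := lanchor L.
pose c := der a x (der a y f) - der a y (der a x f) - der a (bracket L x y) f.
have cz z : c *: z = 0.
  have Jz := bracket_jacobi L x y z; have Jfz := bracket_jacobi L x y (f *: z).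
  have jac w : bracket L x (bracket L y w) + bracket L y (bracket L w x) +
      bracket L w (bracket L x y) = bracket L x (bracket L y w) -
      bracket L y (bracket L x w) - bracket L (bracket L x y) w.
    by rewrite [bracket L w x]bracket_anti bracketNr [bracket L w _]bracket_anti.
  rewrite jac in Jz; rewrite jac !(bracket_leibniz, bracketDr) -/a in Jfz.
  apply: section_ext => p.
  have := congr1 (fun s : section E => s p) Jfz.
  have := congr1 (fun s : section E => s p) Jz.
  rewrite /c !(secD, secN, secZ, sec0, cinfD, cinfN) => Jzp Jfzp.
  have [i ip] := tdom_cover E p.
  rewrite [LHS](basis_sum _ (frame_basis ip)) big1 // => k _.
  have J1 := congr1 (fun v => f p * coord (frame i p) k v) Jzp.
  have J2 := congr1 (coord (frame i p) k) Jfzp.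
  rewrite !(linearD, linearN, linearZ, linear0) /= mulr0 in J1 J2 *.
  rewrite !scalerN /GRing.scale /= in J2.
  by rewrite [X in X *: _](_ : _ = 0) ?scale0r //; lra.
apply/esym/eqP; rewrite -subr_eq0 -/c; apply/eqP/cinf_ext => p; rewrite cinf0.
have [//|cp] := eqVneq (c p) 0.
have s0 z : z p = 0.
  have /(congr1 (fun s : section E => s p)) := cz z.
  by rewrite secZ => /eqP; rewrite scaler_eq0 (negbTE cp) => /eqP.
by rewrite /c !(cinfD, cinfN) /= !s0 !tmap0 !subr0.
Qed.

End Anchors.

(** * Components of sections of a direct sum *)

Section SumBundle.
Context {R : realType} {n : nat} {M : manifold R n} {E F : vbundle M}.
Implicit Types (X Y : section (sum_bundle E F)) (x : section E) (u : section F)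
  (f : cinf M).

Lemma sum_section_ext X Y :
  fst_sec X = fst_sec Y -> snd_sec X = snd_sec Y -> X = Y.
Proof.
move=> E1 E2; apply: section_ext => p.
have := congr1 (fun s : section E => s p) E1.
have := congr1 (fun s : section F => s p) E2.
by move=> /=; case: (X p) (Y p) => [? ?] [? ?] /= -> ->.
Qed.

Lemma fst_secD X Y : fst_sec (X + Y) = fst_sec X + fst_sec Y.
Proof. exact: section_ext. Qed.
Lemma snd_secD X Y : snd_sec (X + Y) = snd_sec X + snd_sec Y.
Proof. exact: section_ext. Qed.
Lemma fst_secZ f X : fst_sec (f *: X) = f *: fst_sec X.
Proof. exact: section_ext. Qed.
Lemma snd_secZ f X : snd_sec (f *: X) = f *: snd_sec X.
Proof. exact: section_ext. Qed.
Lemma fst_secN X : fst_sec (- X) = - fst_sec X.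
Proof. by rewrite -scaleN1r fst_secZ scaleN1r. Qed.
Lemma snd_secN X : snd_sec (- X) = - snd_sec X.
Proof. by rewrite -scaleN1r snd_secZ scaleN1r. Qed.
Lemma fst_pair_sec x u : fst_sec (pair_sec x u) = x.
Proof. exact: section_ext. Qed.
Lemma snd_pair_sec x u : snd_sec (pair_sec x u) = u.
Proof. exact: section_ext. Qed.

End SumBundle.

Lemma tangent_ext (R : realType) (n : nat) (M : manifold R n) (p : M)
  (u v : tangent p) : (forall f, u f = v f) -> u = v.
Proof.
case: u v => [u u1 u2] [v v1 v2] /= /funext uv; move: u1 u2 v1 v2.
by rewrite uv => *; congr Tangent; exact: Prop_irrelevance.
Qed.

(** * The abelian Lie algebroid with zero anchor *)

Section ZeroBracket.
Context {R : realType} {n : nat} {M : manifold R n} (E : vbundle M).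

Let tan_zero_linear (p : M) (k : R) (f g : cinf M) : 0 = k * 0 + 0 :> R.
Proof. by rewrite mulr0 addr0. Qed.

Let tan_zero_leibniz (p : M) (f g : cinf M) : 0 = f p * 0 + g p * 0 :> R.
Proof. by rewrite !mulr0 addr0. Qed.

Definition tan_zero (p : M) : tangent p :=
  Tangent (tan_zero_linear p) (tan_zero_leibniz p).

Let zero_anchor_linear p (k : R) (u v : E p) (f : cinf M) :
  tan_zero p f = k * tan_zero p f + tan_zero p f.
Proof. by rewrite /= mulr0 addr0. Qed.

Let zero_anchor_smooth (x : section E) (f : cinf M) :
  msmooth setT (fun p => tan_zero p f).
Proof. exact: msmooth_cst. Qed.

Definition zero_anchor : tangent_map E := @TangentMap _ _ _ E
  (fun p _ => tan_zero p) zero_anchor_linear zero_anchor_smooth.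

(** Closed with [Defined] so that the bracket and the anchor reduce to zero by computation. *)
Definition zero_algebroid : lie_algebroid E.
Proof.
apply: (@LieAlgebroid _ _ _ E (fun _ _ => 0) zero_anchor) => [k x y z|x y|x y z|x f y].
- by rewrite scaler0 addr0.
- by rewrite oppr0.
- by rewrite !addr0.
- have -> : der zero_anchor x f = 0 by exact: cinf_ext.
  by rewrite scaler0 scale0r addr0.
Defined.

End ZeroBracket.

(** * The dual of left multiplication *)

Section DualRepresentation.
Context {R : realType} {n : nat} {M : manifold R n} {A : vbundle M}.
Variable S : left_symmetric_algebroid A.
Implicit Types (x y z : section A) (xi eta : section (dual_bundle A)) (f : cinf M).

Local Notation rho := (dual_left_mult S).
Local Notation anc := (sanchor S).

(** The right-hand side is C^oo(M)-linear in [y], because the two terms a(x)(f) <xi, y> cancel;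
    hence a section with these pairings exists. *)
Lemma dual_left_multE x xi y :
  pairing (rho x xi) y = der anc x (pairing xi y) - pairing xi (lprod S x y).
Proof.
rewrite /dual_left_mult /dual_rep; case: xgetP => [eta -> etaP|noeta].
  exact: etaP.
(* [xget] falls back on 0 only if no section fits, which is refuted here. *)
have [] := @tensorial_pairing _ _ _ A
    (fun y => der anc x (pairing xi y) - pairing xi (lprod S x y)).
- by move=> u v; rewrite lprodDr !pairingDr derD opprD addrACA.
- move=> f u; rewrite lprod_leibniz pairingDr !pairingZr derM mulrBr.
  by rewrite opprD addrACA subrr addr0.
by move=> eta etaP; case: (noeta eta).
Qed.

Lemma dual_left_multD x xi eta : rho x (xi + eta) = rho x xi + rho x eta.
Proof.
apply: pairing_inj => y; rewrite pairingDl !dual_left_multE !pairingDl derD.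
by rewrite opprD addrACA.
Qed.

Lemma dual_left_multZ x f xi : rho x (f *: xi) = f *: rho x xi + der anc x f *: xi.
Proof.
apply: pairing_inj => y; rewrite pairingDl !pairingZl !dual_left_multE.
by rewrite !pairingZl derM mulrBr addrAC.
Qed.

Lemma dual_left_multDl x y xi : rho (x + y) xi = rho x xi + rho y xi.
Proof.
apply: pairing_inj => z; rewrite pairingDl !dual_left_multE lprodDl derDl.
by rewrite pairingDr opprD addrACA.
Qed.

(** Inherited from the product, which is tensorial in its first argument. It keeps derivatives of
    [f] along [X] only in the Leibniz rule of the semidirect bracket. *)
Lemma dual_left_multZl f x xi : rho (f *: x) xi = f *: rho x xi.
Proof.
apply: pairing_inj => z; rewrite pairingZl !dual_left_multE lprod_tensorial derZl.
by rewrite pairingZr mulrBr.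
Qed.

Lemma dual_left_multB x xi eta : rho x (xi - eta) = rho x xi - rho x eta.
Proof. by rewrite -[xi in RHS](subrK eta) [in RHS]dual_left_multD addrK. Qed.

Lemma dual_left_mult0 x : rho x 0 = 0.
Proof. by rewrite -[0 in LHS](subrr 0) dual_left_multB subrr. Qed.

Lemma dual_left_mult0l xi : rho 0 xi = 0.
Proof. by rewrite -(scale0r (0 : section A)) dual_left_multZl scale0r. Qed.

Lemma dual_left_mult_commutator x y xi :
  rho (commutator S x y) xi = rho x (rho y xi) - rho y (rho x xi).
Proof.
apply: pairing_inj => z; rewrite pairingBl !dual_left_multE.
rewrite (anchor_bracket (sub_adjacent S)) /=.
(* Left symmetry, read as: [L] sends the commutator to the commutator of operators. *)
have -> : lprod S (commutator S x y) z =
    lprod S x (lprod S y z) - lprod S y (lprod S x z).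
  have /eqP := lprod_left_symmetric S x y z.
  rewrite subr_eq addrC addrA addrAC lprodDl lprodNl => /eqP ->.
  by rewrite addrK.
(* The mixed terms a(x) <xi, y.z> + a(y) <xi, x.z> are symmetric in [x] and [y] and drop out. *)
rewrite pairingBr !derB; apply: cinf_ext => p; rewrite !(cinfD, cinfN); lra.
Qed.

(** * The semidirect product Lie algebroid *)

Let SB := sum_bundle A (dual_bundle A).
Implicit Types X Y Z : section SB.

Local Notation sbr := (semidirect_bracket (sub_adjacent S) rho).

Lemma fst_semidirect X Y : fst_sec (sbr X Y) = commutator S (fst_sec X) (fst_sec Y).
Proof. exact: fst_pair_sec. Qed.
Lemma snd_semidirect X Y :
  snd_sec (sbr X Y) = rho (fst_sec X) (snd_sec Y) - rho (fst_sec Y) (snd_sec X).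
Proof. exact: snd_pair_sec. Qed.

Lemma semidirect_linearl (k : R) X Y Z :
  sbr (cinf_cst M k *: X + Y) Z = cinf_cst M k *: sbr X Z + sbr Y Z.
Proof.
apply: sum_section_ext.
  by rewrite fst_secD fst_secZ !fst_semidirect fst_secD fst_secZ commutator_linearl.
rewrite snd_secD snd_secZ !snd_semidirect fst_secD fst_secZ snd_secD snd_secZ.
rewrite dual_left_multD dual_left_multZ dual_left_multDl dual_left_multZl.
by rewrite der_cst scale0r addr0 scalerBr opprD addrACA.
Qed.

Lemma semidirect_anti X Y : sbr X Y = - sbr Y X.
Proof.
apply: sum_section_ext.
  by rewrite fst_secN !fst_semidirect commutator_anti.
by rewrite snd_secN !snd_semidirect opprB.
Qed.

Lemma semidirect_jacobi X Y Z :
  sbr X (sbr Y Z) + sbr Y (sbr Z X) + sbr Z (sbr X Y) = 0.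
Proof.
apply: sum_section_ext.
  by rewrite !fst_secD !fst_semidirect commutator_jacobi; exact: section_ext.
rewrite !snd_secD !(snd_semidirect, fst_semidirect) !dual_left_multB.
rewrite !dual_left_mult_commutator.
(* Only double actions [rho _ (rho _ _)] remain; paired with [y] and evaluated at a point, they are
   real atoms that cancel in pairs. *)
apply: pairing_inj => y; rewrite !(pairingBl, pairingDl).
apply: cinf_ext => p; rewrite !(cinfD, cinfN) [RHS]/= lfunE /=; lra.
Qed.

Lemma semidirect_leibniz X f Y :
  sbr X (f *: Y) = f *: sbr X Y + der (semidirect_anchor anc) X f *: Y.
Proof.
have -> : der (semidirect_anchor anc) X f = der anc (fst_sec X) f by exact: cinf_ext.
apply: sum_section_ext.
  by rewrite fst_secD !fst_secZ !fst_semidirect fst_secZ commutator_leibniz.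
rewrite snd_secD !snd_secZ !snd_semidirect snd_secZ fst_secZ.
by rewrite dual_left_multZ dual_left_multZl scalerBr addrAC.
Qed.

Definition semidirect_dual : lie_algebroid SB := LieAlgebroid
  semidirect_linearl semidirect_anti semidirect_jacobi semidirect_leibniz.

(** * Closedness and nondegeneracy of the natural form *)

Lemma closed_natural_form : closed_form semidirect_dual (natural_form A).
Proof.
move=> X Y Z; rewrite /differential /=.
have dE U f : der (semidirect_anchor anc) U f = der anc (fst_sec U) f by exact: cinf_ext.
have wE U V : form_eval (natural_form A) U V =
    pairing (snd_sec V) (fst_sec U) - pairing (snd_sec U) (fst_sec V).
  by apply: cinf_ext => p; rewrite cinfD cinfN.
rewrite !dE !wE !(fst_semidirect, snd_semidirect) !pairingBl !dual_left_multE.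
rewrite !pairingBr !derB.
(* For X = x + xi, Y = y + eta, Z = z + zeta: a(x) <eta, z> comes once from the first anchor term
   and once, with opposite sign, from the bracket of X and Y; <xi, y.z> cancels between the brackets
   of X, Y and of Y, Z. The rest follows the same pattern. *)
apply: cinf_ext => p; rewrite !(cinfD, cinfN) cinf0; lra.
Qed.

(** Vectors (v, 0) detect the covector part, and the coordinate functionals of a frame detect the
    vector part. *)
Lemma nondegenerate_natural_form : nondegenerate_form (natural_form A).
Proof.
move=> p [u phi] H.
have phi0 : phi = 0.
  apply/lfunP => v; have /= := H (v, 0); rewrite !lfunE /= sub0r.
  by move/eqP; rewrite oppr_eq0 => /eqP.
rewrite phi0; congr (_, _).
have [i ip] := tdom_cover A p.
rewrite (basis_sum u (frame_basis ip)) big1 // => a _.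
have /= := H (0, linfun (coord (frame i p) a : A p -> R^o)).
by rewrite lfunE /= linear0 subr0 => ->; rewrite scale0r.
Qed.

End DualRepresentation.

Theorem theorem4p2 (R : realType) (n : nat) (M : manifold R n) (A : vbundle M)
    (S : left_symmetric_algebroid A) :
  exists P : lie_algebroid (sum_bundle A (dual_bundle A)),
    [/\ is_semidirect_product (sub_adjacent S) (dual_left_mult S) P,
        nondegenerate_form (natural_form A),
        closed_form P (natural_form A)
      & is_phase_space (sub_adjacent S) P].
Proof.
have cl := closed_natural_form S.
exists (semidirect_dual S); split=> //; first exact: nondegenerate_natural_form.
(* The summand [A^*] is abelian, since [L^*] vanishes at x = 0, and the anchor sees only the [A]
   component. *)
exists (zero_algebroid _); split=> // [x y|xi eta|p phi].
- rewrite [LHS]semidirect_bracketE; congr pair_sec.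
  by rewrite !dual_left_mult0 subrr.
- rewrite [LHS]semidirect_bracketE !dual_left_mult0l subrr; congr pair_sec.
  by rewrite /= /commutator lprod0r subrr.
- by apply: tangent_ext => f; exact: tmap0.
Qed.
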